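(* Let $M$ be a module over a commutative ring $A$. If $\operatorname{tr}(M)=A$, then $\operatorname{Supp}(M)=\operatorname{Spec}(A)$. If moreover $M$ is a finitely generated projective $A$-module, then the converse holds: $\operatorname{Supp}(M)=\operatorname{Spec}(A)$ implies $\operatorname{tr}(M)=A$.
   Context: The trace ideal $\operatorname{tr}(M)$ is the image of the canonical $A$-linear map $\operatorname{Hom}_A(M,A)\otimes_A M\to A$, $f\otimes x\mapsto f(x)$. $\operatorname{Supp}(M)=\{\mathfrak p\in\operatorname{Spec}(A): M_{\mathfrak p}\neq 0\}$. *)

(* Defs.v *)
From HB Require Import structures.
From mathcomp Require Import all_boot all_algebra.
From mathcomp Require Import boolp classical_sets functions.
From mathcomp Require Import ring.

Set Implicit Arguments.
Unset Strict Implicit.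
Unset Printing Implicit Defensive.

Import GRing.Theory.
Local Open Scope ring_scope.
Local Open Scope quotient_scope.
Local Open Scope classical_set_scope.

(* Rings are [comPzRingType]s, so that the zero ring is not excluded.         *)

(* [linHom U V] is a copy of [{linear U -> V}] carrying the pointwise  *)
(* module structure.                                                          *)
Definition linHom (A : comPzRingType) (U V : lmodType A) := {linear U -> V}.

Section LinHomTheory.
Context {A : comPzRingType} {U V : lmodType A}.
Implicit Types f g h : linHom U V.

HB.instance Definition _ := gen_eqMixin (linHom U V).
HB.instance Definition _ := gen_choiceMixin (linHom U V).

Lemma linHomP f g : (forall x, f x = g x) -> f = g.
Proof.
case: f => f [[f1] [f2]]; case: g => g [[g1] [g2]] /= fg.
have {}fg : f = g by apply/funext.
by subst g; rewrite (Prop_irrelevance f1 g1) (Prop_irrelevance f2 g2).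
Qed.

Definition linHom_zero : linHom U V := \0.
Definition linHom_opp f : linHom U V := \- f.
Definition linHom_add f g : linHom U V := f \+ g.
Definition linHom_scale (a : A) f : linHom U V := a \*: f.

Let addA : associative linHom_add.
Proof. by move=> f g h; apply: linHomP => x; exact: addrA. Qed.
Let addC : commutative linHom_add.
Proof. by move=> f g; apply: linHomP => x; exact: addrC. Qed.
Let add0 : left_id linHom_zero linHom_add.
Proof. by move=> f; apply: linHomP => x; exact: add0r. Qed.
Let addN : left_inverse linHom_zero linHom_opp linHom_add.
Proof. by move=> f; apply: linHomP => x; exact: addNr. Qed.

HB.instance Definition _ := GRing.isZmodule.Build (linHom U V)
  addA addC add0 addN.

Let scaleA (a b : A) f :
  linHom_scale a (linHom_scale b f) = linHom_scale (a * b) f.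
Proof. by apply: linHomP => x; exact: scalerA. Qed.
Let scale1 : left_id 1 linHom_scale.
Proof. by move=> f; apply: linHomP => x; exact: scale1r. Qed.
Let scaleDr : right_distributive linHom_scale +%R.
Proof. by move=> a f g; apply: linHomP => x; exact: scalerDr. Qed.
Let scaleDl f : {morph linHom_scale^~ f : a b / a + b}.
Proof. by move=> a b; apply: linHomP => x; exact: scalerDl. Qed.

HB.instance Definition _ :=
  GRing.Zmodule_isLmodule.Build A (linHom U V) scaleA scale1 scaleDr scaleDl.

End LinHomTheory.

(* The tensor product [tensor U V] over [A] is the monoid of finite formal    *)
(* sums of pairs (lists, added by concatenation) modulo the congruence        *)
(* generated by commutativity and the bilinearity relations. It is a group    *)
(* because (- u, v) is an opposite of (u, v).                                 *)
Section Tensor.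
Context {A : comPzRingType} (U V : lmodType A).
Implicit Types (u : U) (v : V) (s t : seq (U * V)).

Inductive tensor_rel : seq (U * V) -> seq (U * V) -> Prop :=
| tensor_refl s : tensor_rel s s
| tensor_sym s t : tensor_rel s t -> tensor_rel t s
| tensor_trans t s r : tensor_rel s t -> tensor_rel t r -> tensor_rel s r
| tensor_cat s s' t t' :
    tensor_rel s s' -> tensor_rel t t' -> tensor_rel (s ++ t) (s' ++ t')
| tensor_catC s t : tensor_rel (s ++ t) (t ++ s)
| tensor_0l v : tensor_rel [:: (0, v)] [::]
| tensor_Dl u u' v : tensor_rel [:: (u + u', v)] [:: (u, v); (u', v)]
| tensor_Dr u v v' : tensor_rel [:: (u, v + v')] [:: (u, v); (u, v')]
| tensor_Z (a : A) u v : tensor_rel [:: (a *: u, v)] [:: (u, a *: v)].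

Definition tensor_eq s t : bool := `[< tensor_rel s t >].

Lemma tensor_eq_equiv : equiv_class_of tensor_eq.
Proof.
split=> [s|s t|t s r].
- by apply/asboolP; exact: tensor_refl.
- by apply/asboolP/asboolP; exact: tensor_sym.
- by move=> /asboolP st /asboolP tr; apply/asboolP; exact: tensor_trans tr.
Qed.

Canonical tensor_equiv := EquivRelPack tensor_eq_equiv.
Canonical tensor_encModRel := defaultEncModRel tensor_eq.

Definition tensor := {eq_quot tensor_eq}.
HB.instance Definition _ := Choice.on tensor.
HB.instance Definition _ := EqQuotient.on tensor.

Lemma tensorP s t :
  \pi_tensor s = \pi_tensor t :> tensor <-> tensor_rel s t.
Proof.
split=> [/eqP|st]; first by rewrite piE => /asboolP.
by apply/eqP; rewrite piE; apply/asboolP.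
Qed.

Lemma tensor_ind_pi (P : tensor -> Prop) :
  (forall s, P (\pi_tensor s)) -> forall x, P x.
Proof. by move=> Ppi x; rewrite -[x]reprK. Qed.

Lemma tensor_repr s : tensor_rel (repr (\pi_tensor s)) s.
Proof. by apply/tensorP; rewrite reprK. Qed.

Definition tensor_zero : tensor := \pi_tensor [::].
Definition tensor_add (x y : tensor) : tensor := \pi_tensor (repr x ++ repr y).
Definition tensor_map (a : A) s := [seq (a *: w.1, w.2) | w <- s].
Definition tensor_scale (a : A) (x : tensor) : tensor :=
  \pi_tensor (tensor_map a (repr x)).
Definition tensor_opp (x : tensor) : tensor := tensor_scale (- 1) x.

Lemma tensor_map_rel a s t :
  tensor_rel s t -> tensor_rel (tensor_map a s) (tensor_map a t).
Proof.
elim=> {s t}; rewrite /tensor_map.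
- by move=> s; exact: tensor_refl.
- by move=> s t _; exact: tensor_sym.
- by move=> t s r _ + _; exact: tensor_trans.
- by move=> s s' t t' _ ss' _ tt'; rewrite !map_cat; exact: tensor_cat.
- by move=> s t; rewrite !map_cat; exact: tensor_catC.
- by move=> v; rewrite /= scaler0; exact: tensor_0l.
- by move=> u u' v; rewrite /= scalerDr; exact: tensor_Dl.
- by move=> u v v' /=; exact: tensor_Dr.
- by move=> b u v; rewrite /= scalerA mulrC -scalerA; exact: tensor_Z.
Qed.

Lemma tensor_addE s t :
  tensor_add (\pi_tensor s) (\pi_tensor t) = \pi_tensor (s ++ t).
Proof. by apply/tensorP/tensor_cat; exact: tensor_repr. Qed.

Lemma tensor_scaleE a s :
  tensor_scale a (\pi_tensor s) = \pi_tensor (tensor_map a s).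
Proof. by apply/tensorP/tensor_map_rel; exact: tensor_repr. Qed.

Let addA : associative tensor_add.
Proof.
elim/tensor_ind_pi=> s; elim/tensor_ind_pi=> t; elim/tensor_ind_pi=> r.
by rewrite !tensor_addE catA.
Qed.

Let addC : commutative tensor_add.
Proof.
elim/tensor_ind_pi=> s; elim/tensor_ind_pi=> t.
by rewrite !tensor_addE; apply/tensorP; exact: tensor_catC.
Qed.

Let add0 : left_id tensor_zero tensor_add.
Proof. by elim/tensor_ind_pi=> s; rewrite tensor_addE. Qed.

Lemma tensor_mapD a b s :
  tensor_rel (tensor_map (a + b) s) (tensor_map a s ++ tensor_map b s).
Proof.
elim: s => [|[u v] s IHs] /=; first exact: tensor_refl.
rewrite scalerDl.
apply: (@tensor_trans ([:: (a *: u, v); (b *: u, v)]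
  ++ (tensor_map a s ++ tensor_map b s))).
  by apply: (@tensor_cat [:: _]) => //; exact: tensor_Dl.
apply: (@tensor_cat [:: _] [:: _]); first exact: tensor_refl.
rewrite -/(cat [:: _] _) -[(b *: u, v) :: tensor_map b s]cat1s !catA.
by apply: tensor_cat; [exact: tensor_catC | exact: tensor_refl].
Qed.

Lemma tensor_map0 s : tensor_rel (tensor_map 0 s) [::].
Proof.
elim: s => [|[u v] s IHs] /=; first exact: tensor_refl.
rewrite scale0r; apply: (@tensor_cat [:: _] [::] _ [::]) => //.
exact: tensor_0l.
Qed.

Lemma tensor_map1 s : tensor_map 1 s = s.
Proof. by elim: s => //= -[u v] s ->; rewrite scale1r. Qed.

Let addN : left_inverse tensor_zero tensor_opp tensor_add.
Proof.
elim/tensor_ind_pi=> s; rewrite /tensor_opp tensor_scaleE tensor_addE.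
apply/tensorP; rewrite -{2}[s]tensor_map1; apply: tensor_trans.
  by apply: tensor_sym; exact: tensor_mapD.
by rewrite addNr; exact: tensor_map0.
Qed.

HB.instance Definition _ := GRing.isZmodule.Build tensor addA addC add0 addN.

Let scaleA (a b : A) x :
  tensor_scale a (tensor_scale b x) = tensor_scale (a * b) x.
Proof.
elim/tensor_ind_pi: x => s; rewrite !tensor_scaleE; congr (\pi_tensor _).
by rewrite /tensor_map -map_comp; apply: eq_map => w /=; rewrite scalerA.
Qed.
Let scale1 : left_id 1 tensor_scale.
Proof. by elim/tensor_ind_pi=> s; rewrite tensor_scaleE tensor_map1. Qed.
Let scaleDr : right_distributive tensor_scale +%R.
Proof.
move=> a; elim/tensor_ind_pi=> s; elim/tensor_ind_pi=> t.
rewrite [_ + _ in LHS]tensor_addE !tensor_scaleE [RHS]tensor_addE.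
by rewrite /tensor_map map_cat.
Qed.
Let scaleDl x : {morph tensor_scale^~ x : a b / a + b}.
Proof.
move=> a b; elim/tensor_ind_pi: x => s.
rewrite !tensor_scaleE [RHS]tensor_addE; apply/tensorP; exact: tensor_mapD.
Qed.

HB.instance Definition _ :=
  GRing.Zmodule_isLmodule.Build A tensor scaleA scale1 scaleDr scaleDl.

Definition tens u v : tensor := \pi_tensor [:: (u, v)].

End Tensor.

(* The universal property of the tensor product, in curried form: a bilinear  *)
(* map is given as a linear map [U -> linHom V W].                            *)
Section TensorLift.
Context {A : comPzRingType} {U V W : lmodType A}.
Variable f : {linear U -> linHom V W}.

Definition tensor_lift (x : tensor U V) : W := \sum_(w <- repr x) f w.1 w.2.

Lemma tensor_lift_rel s t :
  tensor_rel s t -> \sum_(w <- s) f w.1 w.2 = \sum_(w <- t) f w.1 w.2.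
Proof.
elim=> {s t} //.
- by move=> t s r _ -> _ ->.
- by move=> s s' t t' _ ss' _ tt'; rewrite !big_cat/= ss' tt'.
- by move=> s t; rewrite !big_cat/= addrC.
- by move=> v; rewrite big_seq1 big_nil /= linear0.
- by move=> u u' v; rewrite big_seq1 big_cons big_seq1 /= linearD.
- by move=> u v v'; rewrite big_seq1 big_cons big_seq1 /= linearD.
- by move=> a u v; rewrite !big_seq1 /= [f _]linearZ [RHS]linearZ.
Qed.

Lemma tensor_lift_pi s :
  tensor_lift (\pi_(tensor U V) s) = \sum_(w <- s) f w.1 w.2.
Proof. exact/tensor_lift_rel/tensor_repr. Qed.

Lemma tensor_lift_is_linear : linear tensor_lift.
Proof.
move=> a x y; rewrite -[x]reprK -[y]reprK; move: (repr x) (repr y) => s t.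
rewrite [_ *: _]tensor_scaleE [_ + _ in LHS]tensor_addE !tensor_lift_pi.
rewrite big_cat big_map scaler_sumr /=; congr (_ + _).
by apply: eq_bigr => w _; rewrite linearZ.
Qed.

HB.instance Definition _ :=
  GRing.isLinear.Build A (tensor U V) W *:%R tensor_lift tensor_lift_is_linear.

Lemma tensor_liftE u v : tensor_lift (tens u v) = f u v.
Proof. by rewrite tensor_lift_pi big_seq1. Qed.

End TensorLift.

Section TraceIdeal.
Context {A : comPzRingType} (M : lmodType A).

(* The bilinear map (f, x) |-> f x is the identity of [linHom M A^o] in       *)
(* curried form.                                                              *)
Definition trace_map : {linear tensor (linHom M A^o) M -> A^o} :=
  tensor_lift (idfun : {linear linHom M A^o -> linHom M A^o}).

Lemma trace_mapE (f : linHom M A^o) (x : M) : trace_map (tens f x) = f x.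
Proof. exact: tensor_liftE. Qed.

Definition trace_ideal : set A := range trace_map.

End TraceIdeal.

Record prime_ideal (A : comPzRingType) (p : set A) : Prop := PrimeIdeal {
  prime_ideal0 : p 0;
  prime_idealD : forall x y, p x -> p y -> p (x + y);
  prime_idealM : forall a x, p x -> p (a * x);
  prime_ideal1 : ~ p 1;
  prime_ideal_prime : forall x y, p (x * y) -> p x \/ p y }.

Record spec (A : comPzRingType) := Spec {
  spec_set :> set A;
  specP : prime_ideal spec_set }.

(* [localization p M] is M_p: the classes of fractions m / s with s outside p,*)
(* where m / s = n / t when u (t m - s n) = 0 for some u outside p.           *)
Section Localization.
Context {A : comPzRingType} (p : spec A) (M : lmodType A).

Record denominator := Denominator { den : A; denP : ~ spec_set p den }.

HB.instance Definition _ := gen_eqMixin denominator.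
HB.instance Definition _ := gen_choiceMixin denominator.

Definition den1 : denominator := Denominator (prime_ideal1 (specP p)).

Lemma den_mul_subproof (s t : denominator) : ~ spec_set p (den s * den t).
Proof. by case/(prime_ideal_prime (specP p)) => /denP. Qed.
Definition den_mul (s t : denominator) := Denominator (@den_mul_subproof s t).

Definition loc_rel (x y : M * denominator) : Prop :=
  exists u : denominator, den u *: (den y.2 *: x.1 - den x.2 *: y.1) = 0.

Definition loc_eq (x y : M * denominator) : bool := `[< loc_rel x y >].

Lemma loc_eq_equiv : equiv_class_of loc_eq.
Proof.
split=> [x|x y|y x z].
- by apply/asboolP; exists den1; rewrite subrr scaler0.
- have sym a b : loc_rel a b -> loc_rel b a.
    by case=> u uE; exists u; rewrite -opprB scalerN uE oppr0.
  by apply/asboolP/asboolP; exact: sym.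
- case: x y z => [m s] [n t] [r w] /asboolP[/= u uE] /asboolP[/= v vE].
  apply/asboolP; exists (den_mul (den_mul u v) t) => /=.
  have -> : (den u * den v * den t) *: (den w *: m - den s *: r) =
      (den v * den w) *: (den u *: (den t *: m - den s *: n)) +
      (den u * den s) *: (den v *: (den w *: n - den t *: r)).
    rewrite !scalerBr !scalerA addrA; congr (_ - _); last first.
      by congr (_ *: _); ring.
    rewrite (_ : den u * den s * den v * den w = den v * den w * den u * den s);
      last by ring.
    by rewrite addrNK; congr (_ *: _); ring.
  by rewrite uE vE !scaler0 addr0.
Qed.

Canonical loc_equiv := EquivRelPack loc_eq_equiv.
Canonical loc_encModRel := defaultEncModRel loc_eq.

Definition localization := {eq_quot loc_eq}.
HB.instance Definition _ := Choice.on localization.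
HB.instance Definition _ := EqQuotient.on localization.

Definition loc_frac (m : M) (s : denominator) : localization :=
  \pi_localization (m, s).

Lemma loc_fracP m n s t : loc_frac m s = loc_frac n t <->
  exists u : denominator, den u *: (den t *: m - den s *: n) = 0.
Proof.
split=> [/eqP|st]; first by rewrite piE => /asboolP.
by apply/eqP; rewrite piE; apply/asboolP.
Qed.

Lemma loc_fracW (P : localization -> Prop) :
  (forall m s, P (loc_frac m s)) -> forall x, P x.
Proof. by move=> Pfrac x; rewrite -[x]reprK; case: (repr x). Qed.

Lemma loc_frac_eq m n s t :
  den t *: m = den s *: n -> loc_frac m s = loc_frac n t.
Proof.
by move=> mn; apply/loc_fracP; exists den1; rewrite mn subrr scaler0.
Qed.

Lemma loc_frac_repr m s :
  loc_frac (repr (loc_frac m s)).1 (repr (loc_frac m s)).2 = loc_frac m s.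
Proof. by rewrite /loc_frac -surjective_pairing reprK. Qed.

Definition loc_zero : localization := loc_frac 0 den1.
Definition loc_add (x y : localization) : localization :=
  loc_frac (den (repr y).2 *: (repr x).1 + den (repr x).2 *: (repr y).1)
       (den_mul (repr x).2 (repr y).2).
Definition loc_scale (a : A) (x : localization) : localization :=
  loc_frac (a *: (repr x).1) (repr x).2.
Definition loc_opp (x : localization) : localization := loc_scale (- 1) x.

Lemma loc_scaleE a m s : loc_scale a (loc_frac m s) = loc_frac (a *: m) s.
Proof.
rewrite /loc_scale; have /loc_fracP[u] := loc_frac_repr m s.
case: (repr _) => n t /= uE; apply/loc_fracP; exists u.
apply: etrans (_ : a *: 0 = _); last exact: scaler0.
rewrite -uE !scalerBr !scalerA; congr (_ *: _ - _ *: _); ring.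
Qed.

Lemma loc_addE m n s t : loc_add (loc_frac m s) (loc_frac n t) =
  loc_frac (den t *: m + den s *: n) (den_mul s t).
Proof.
rewrite /loc_add; have /loc_fracP[u] := loc_frac_repr m s.
have /loc_fracP[v] := loc_frac_repr n t.
case: (repr _) => n' t' /= vE; case: (repr _) => m' s' /= uE.
apply/loc_fracP; exists (den_mul u v) => /=.
apply: etrans
  (_ : (den v * den t * den t') *: 0 + (den u * den s * den s') *: 0 = _);
  last by rewrite !scaler0 addr0.
rewrite -{1}uE -vE !(scalerBr, scalerDr, scalerA) opprD addrACA.
by congr (_ *: _ - _ *: _ + (_ *: _ - _ *: _)); ring.
Qed.

Let addA : associative loc_add.
Proof.
elim/loc_fracW=> m s; elim/loc_fracW=> n t; elim/loc_fracW=> r u.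
rewrite !loc_addE; apply: loc_frac_eq => /=.
rewrite !(scalerDr, scalerA) !addrA.
by congr (_ *: _ + _ *: _ + _ *: _); ring.
Qed.

Let addC : commutative loc_add.
Proof.
elim/loc_fracW=> m s; elim/loc_fracW=> n t; rewrite !loc_addE.
apply: loc_frac_eq => /=.
by rewrite [in RHS]addrC; congr (_ *: _); exact: mulrC.
Qed.

Let add0 : left_id loc_zero loc_add.
Proof.
elim/loc_fracW=> m s; rewrite loc_addE; apply: loc_frac_eq => /=.
by rewrite scaler0 add0r scale1r mul1r.
Qed.

Let addN : left_inverse loc_zero loc_opp loc_add.
Proof.
elim/loc_fracW=> m s; rewrite /loc_opp loc_scaleE loc_addE.
apply: loc_frac_eq => /=.
by rewrite scaleN1r scalerN addNr !scaler0.
Qed.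

HB.instance Definition _ :=
  GRing.isZmodule.Build localization addA addC add0 addN.

Let scaleA (a b : A) x : loc_scale a (loc_scale b x) = loc_scale (a * b) x.
Proof. by elim/loc_fracW: x => m s; rewrite !loc_scaleE scalerA. Qed.
Let scale1 : left_id 1 loc_scale.
Proof. by elim/loc_fracW=> m s; rewrite loc_scaleE scale1r. Qed.
Let scaleDr : right_distributive loc_scale +%R.
Proof.
move=> a; elim/loc_fracW=> m s; elim/loc_fracW=> n t.
rewrite [_ + _ in LHS]loc_addE !loc_scaleE [RHS]loc_addE.
apply: loc_frac_eq => /=; congr (_ *: _).
by rewrite scalerDr !scalerA; congr (_ *: _ + _ *: _); exact: mulrC.
Qed.
Let scaleDl x : {morph loc_scale^~ x : a b / a + b}.
Proof.
move=> a b; elim/loc_fracW: x => m s; rewrite !loc_scaleE [RHS]loc_addE.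
apply: loc_frac_eq => /=; rewrite -scalerDr !scalerA -scalerDl scalerA.
by congr (_ *: _); ring.
Qed.

HB.instance Definition _ :=
  GRing.Zmodule_isLmodule.Build A localization scaleA scale1 scaleDr scaleDl.

Lemma loc_frac_eq0 m s :
  loc_frac m s = 0 <-> exists u : denominator, den u *: m = 0.
Proof.
split=> [/loc_fracP[u /= uE]|[u uE]].
  by exists u; rewrite -uE scaler0 subr0 scale1r.
by apply/loc_fracP; exists u => /=; rewrite scaler0 subr0 scale1r.
Qed.

(* Denominators act bijectively, so the A-module M_p is an A_p-module.        *)
Lemma loc_scale_inj s : injective (fun x : localization => den s *: x).
Proof.
elim/loc_fracW=> m t; elim/loc_fracW=> n r.
rewrite [den s *: _]loc_scaleE [den s *: loc_frac n _]loc_scaleE.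
move=> /loc_fracP[u uE].
apply/loc_fracP; exists (den_mul u s) => /=; rewrite -[RHS]uE.
by rewrite !(scalerBr, scalerA); congr (_ *: _ - _ *: _); ring.
Qed.

Lemma loc_scale_surj s (x : localization) : exists y, x = den s *: y.
Proof.
elim/loc_fracW: x => m t; exists (loc_frac m (den_mul s t)).
by rewrite [RHS]loc_scaleE; apply: loc_frac_eq; rewrite /= scalerA mulrC.
Qed.

End Localization.

Definition supp (A : comPzRingType) (M : lmodType A) : set (spec A) :=
  [set p | exists x : localization p M, x <> 0].

Definition finitely_generated (A : comPzRingType) (M : lmodType A) : Prop :=
  exists (n : nat) (e : 'I_n -> M),
    forall x, exists a : 'I_n -> A, x = \sum_(i < n) a i *: e i.

Definition projective (A : comPzRingType) (M : lmodType A) : Prop :=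
  forall (N P : lmodType A) (g : {linear N -> P}) (f : {linear M -> P}),
    (forall y, exists x, g x = y) ->
    exists h : {linear M -> N}, forall x, g (h x) = f x.

(* Main.v *)
Require Import Defs.
From HB Require Import structures.
From mathcomp Require Import all_boot all_algebra.
From mathcomp Require Import boolp classical_sets functions.

Set Implicit Arguments.
Unset Strict Implicit.
Unset Printing Implicit Defensive.

Import GRing.Theory.
Local Open Scope ring_scope.
Local Open Scope classical_set_scope.

(** If [1 = \sum_i f_i x_i] and [s] is outside [p] and kills every [x_i], then
[s = \sum_i f_i (s x_i) = 0] lies in [p], which is absurd; so [M_p] is nonzero.
Conversely, if the trace ideal is proper, it lies in a maximal ideal [p]. The
dual basis [x = \sum_i f_i x *: e_i] of a finitely generated projective [M]
gives [M = tr(M) M], hence [M = p M], and [M_p = 0] by Nakayama's lemma. *)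

(** * Primes containing a proper ideal *)

Record is_ideal (A : comPzRingType) (I : set A) : Prop := IsIdeal {
  is_ideal0 : I 0;
  is_idealD : forall x y, I x -> I y -> I (x + y);
  is_idealM : forall a x, I x -> I (a * x) }.

Lemma prime_is_ideal (A : comPzRingType) (p : spec A) : is_ideal p.
Proof. by case: p => p []. Qed.

(** The set is the ideal [I + A x]. *)
Lemma is_ideal_adjoin (A : comPzRingType) (I : set A) (x : A) :
  is_ideal I -> is_ideal [set z | exists a, I (z - a * x)].
Proof.
move=> II; split=> [|y z [a ya] [b zb]|b y [a ya]] /=.
- by exists 0; rewrite mul0r subr0; exact: is_ideal0.
- by exists (a + b); rewrite mulrDl opprD addrACA; exact: is_idealD.
- by exists (b * a); rewrite -mulrA -mulrBr; exact: is_idealM.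
Qed.

(** For [x] outside [m], maximality forces [m + A x] to contain 1, so some [1 - a * x] lies in [m];
    multiplying by [y] puts [y] in [m] once [x * y] is there. *)
Lemma maximal_ideal_prime (A : comPzRingType) (m : set A) :
  is_ideal m -> ~ m 1 ->
  (forall J, is_ideal J -> ~ J 1 -> m `<=` J -> J `<=` m) ->
  prime_ideal m.
Proof.
move=> mI m1 mmax; split=> //; try by case: mI.
move=> x y mxy; have [mx|nmx] := pselect (m x); [by left | right].
pose J := [set z | exists a, m (z - a * x)].
have JI : is_ideal J by exact: is_ideal_adjoin.
have [[a ma]|J1] := pselect (J 1); last first.
  case: nmx; apply: (mmax J) => //.
    by move=> z mz; exists 0; rewrite mul0r subr0.
  by exists 1; rewrite mul1r subrr; exact: is_ideal0.
have -> : y = y * (1 - a * x) + a * (x * y).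
  by rewrite mulrBr mulr1 mulrA [y * _]mulrC subrK.
by apply: is_idealD => //; exact: is_idealM.
Qed.

Lemma proper_ideal_sub_prime (A : comPzRingType) (I : set A) :
  is_ideal I -> ~ I 1 -> exists p : spec A, I `<=` p.
Proof.
move=> II I1.
(* [Zorn_bigcup] also requires an upper bound of the empty chain, so the union
   with [I] is built into the predicate. *)
pose P (X : set A) := is_ideal (I `|` X) /\ ~ (I `|` X) 1.
have [F FP Ftot|X [[XI X1] Xmax]] := @Zorn_bigcup A P.
  split; last by case=> // -[X FX Xe]; have [_] := FP _ FX; apply; right.
  split=> [|x y|a x].
  - by left; exact: is_ideal0.
  - case=> [Ix|[X FX Xx]] [Iy|[Y FY Yy]].
    + by left; exact: is_idealD.
    + have [/is_idealD] := FP _ FY.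
      move=> /(_ x y (or_introl Ix) (or_intror Yy)).
      by case=> [?|?]; [left | right; exists Y].
    + have [/is_idealD] := FP _ FX.
      move=> /(_ x y (or_intror Xx) (or_introl Iy)).
      by case=> [?|?]; [left | right; exists X].
    (* Both elements lie in the larger of the two comparable members of the chain. *)
    + have [XY|YX] := Ftot _ _ FX FY.
        have [/is_idealD] := FP _ FY.
        move=> /(_ x y (or_intror (XY _ Xx)) (or_intror Yy)).
        by case=> [?|?]; [left | right; exists Y].
      have [/is_idealD] := FP _ FX.
      move=> /(_ x y (or_intror Xx) (or_intror (YX _ Yy))).
      by case=> [?|?]; [left | right; exists X].
  - case=> [Ix|[X FX Xx]]; first by left; exact: is_idealM.
    have [/is_idealM] := FP _ FX; move=> /(_ a x (or_intror Xx)).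
    by case=> [?|?]; [left | right; exists X].
have pI : prime_ideal (I `|` X).
  (* A point [z] of [J] outside both [I] and [X] makes [J] a strictly larger set satisfying [P],
     against the maximality of [X]. *)
  apply: maximal_ideal_prime => // J JI J1 XJ z Jz; apply: contrapT => nz.
  have IJ : I `|` J = J by apply/setUidPr => w Iw; apply: XJ; left.
  apply: (Xmax J); last by rewrite /P IJ.
  split=> [w Xw|JX]; first by apply: XJ; right.
  by apply: nz; right; exact: JX.
by exists (Spec pI) => x; left.
Qed.

(** * The trace ideal and the support *)

Lemma trace_ideal_is_ideal (A : comPzRingType) (M : lmodType A) :
  is_ideal (trace_ideal M).
Proof.
split=> [|_ _ [x _ <-] [y _ <-]|a _ [x _ <-]].
- by exists 0; rewrite // linear0.
- by exists (x + y); rewrite // linearD.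
- by exists (a *: x); rewrite // linearZ.
Qed.

Lemma trace_ideal_eval (A : comPzRingType) (M : lmodType A)
  (f : {linear M -> A^o}) (x : M) : trace_ideal M (f x).
Proof. by exists (tens (f : linHom M A^o) x) => //; rewrite trace_mapE. Qed.

(** Every tensor is represented by a finite list of pairs, so an element of the trace ideal is a
    finite sum of values [f x]. *)
Lemma trace_ideal_ind (A : comPzRingType) (M : lmodType A) (I : set A) :
  is_ideal I -> (forall (f : {linear M -> A^o}) x, I (f x)) ->
  trace_ideal M `<=` I.
Proof.
move=> II If _ [x _ <-]; rewrite /trace_map /= /tensor_lift.
apply: (big_ind I) => [|y z|w _]; first exact: (is_ideal0 II).
- exact: (is_idealD II).
- exact: If.
Qed.

Lemma not_suppP (A : comPzRingType) (M : lmodType A) (p : spec A) :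
  ~ supp M p <-> forall x : M, exists u : A, ~ spec_set p u /\ u *: x = 0.
Proof.
split=> [np x|kill [y]].
  have [u uE] : exists u : denominator p, den u *: x = 0.
    apply/(loc_frac_eq0 x (den1 p)); apply: contrapT => x0; apply: np.
    by exists (loc_frac x (den1 p)).
  by exists (den u); split=> //; exact: denP.
case: (repr y) (reprK y) => m s <-; apply; apply/loc_frac_eq0.
by have [u [pu uE]] := kill m; exists (Denominator pu).
Qed.

(** This set is the kernel of the map from [A] to its localization at [p]; primality keeps products
    of denominators outside [p]. *)
Lemma torsion_ideal (A : comPzRingType) (p : spec A) :
  is_ideal [set a | exists u, ~ spec_set p u /\ u * a = 0].
Proof.
have pP := specP p.
split=> [|x y [u [pu ux]] [v [pv vy]]|a x [u [pu ux]]] /=.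
- by exists 1; rewrite mulr0; split=> //; exact: prime_ideal1.
- exists (u * v); split; first by move=> /(prime_ideal_prime pP)[].
  by rewrite mulrDr {1}[u * v]mulrC -!mulrA ux vy !mulr0 addr0.
- by exists u; rewrite mulrCA ux mulr0.
Qed.

(** If [M_p = 0], whatever kills [x] kills [f x], so the trace ideal lies in the kernel of
    [A -> A_p]. Then 1 does too, giving [u * 1 = 0] with [u] outside [p]. *)
Lemma trace_full_supp (A : comPzRingType) (M : lmodType A) (p : spec A) :
  trace_ideal M 1 -> supp M p.
Proof.
move=> tr1; apply: contrapT => /not_suppP kill.
have [|u [pu]] := trace_ideal_ind (torsion_ideal p) _ tr1.
  move=> f x; have [u [pu ux]] := kill x; exists u; split=> //.
  (* The product is reread as the scalar action on [A^o], so that linearity of [f] applies. *)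
  by rewrite -[u * _]/(u *: (f x : A^o)) -linearZ ux linear0.
rewrite mulr1 => u0; apply: pu; rewrite u0.
exact: is_ideal0 (prime_is_ideal p).
Qed.

(** * Nakayama's lemma at a prime *)

(** Peeling off one generator at a time matches the elimination in [local_nakayama]. *)
Fixpoint ideal_span (A : comPzRingType) (M : lmodType A) (I : set A)
    (s : seq M) (m : M) : Prop :=
  if s is x :: s' then exists a, I a /\ ideal_span I s' (m - a *: x)
  else m = 0.

Section IdealSpan.
Context {A : comPzRingType} {M : lmodType A} (I : set A) (II : is_ideal I).
Implicit Types (s : seq M) (m n : M).

Lemma ideal_spanD s m n :
  ideal_span I s m -> ideal_span I s n -> ideal_span I s (m + n).
Proof.
elim: s m n => [|x s IHs] m n /=; first by move=> -> ->; rewrite addr0.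
move=> [a [Ia ma]] [b [Ib nb]]; exists (a + b).
split; first exact: is_idealD.
by rewrite scalerDl opprD addrACA; exact: IHs.
Qed.

Lemma ideal_spanZ s (b : A) m : ideal_span I s m -> ideal_span I s (b *: m).
Proof.
elim: s m => [|x s IHs] m /=; first by move=> ->; rewrite scaler0.
move=> [a [Ia ma]]; exists (b * a); split; first exact: is_idealM.
by rewrite -scalerA -scalerBr; exact: IHs.
Qed.

Lemma ideal_span_sum k (a : 'I_k -> A) (e : 'I_k -> M) (r : seq 'I_k) :
  (forall i, I (a i)) -> ideal_span I (map e r) (\sum_(i <- r) a i *: e i).
Proof.
move=> Ia; elim: r => [|i r IHr] /=; first by rewrite big_nil.
by exists (a i); rewrite big_cons addrC addKr.
Qed.

End IdealSpan.

Section Nakayama.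
Context {A : comPzRingType} {M : lmodType A} (p : spec A).

(** A product of elements outside [p], one killing each generator, stays outside [p] and kills every
    combination. *)
Lemma torsion_ideal_span (s : seq M) (m : M) :
  {in s, forall x, exists u, ~ spec_set p u /\ u *: x = 0} ->
  ideal_span p s m ->
  exists u, ~ spec_set p u /\ u *: m = 0.
Proof.
elim: s m => [|x s IHs] m kill /=.
  move=> ->; exists 1; rewrite scaler0; split=> //.
  exact: prime_ideal1 (specP p).
move=> [a [pa /IHs[|u [pu uE]]]].
  by move=> y ys; apply: kill; rewrite inE ys orbT.
have [|v [pv vE]] := kill x; first exact: mem_head.
exists (u * v); split; first by move=> /(prime_ideal_prime (specP p))[].
rewrite -[m](subrK (a *: x)) scalerDr {1}[u * v]mulrC -!scalerA uE.
by rewrite [v *: (a *: x)]scalerA mulrC -scalerA vE !scaler0 addr0.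
Qed.

(* Denominators [u] are allowed in the hypothesis so that it survives the
   elimination of a generator [x] from [u x = a x + y], i.e. [(u - a) x = y]. *)
Lemma local_nakayama (s : seq M) :
  {in s, forall x, exists u, ~ spec_set p u /\ ideal_span p s (u *: x)} ->
  {in s, forall x, exists u, ~ spec_set p u /\ u *: x = 0}.
Proof.
have pI := prime_is_ideal p; have pP := specP p.
elim: s => [|x s IHs] //= sp.
have [|u [pu [a [pa ux]]]] := sp x; first exact: mem_head.
have pua : ~ spec_set p (u - a).
  by move=> h; apply: pu; rewrite -[u](subrK a); exact: is_idealD.
have kill : {in s, forall z, exists u, ~ spec_set p u /\ u *: z = 0}.
  apply: IHs => z zs.
  have [|v [pv [b [pb vz]]]] := sp z; first by rewrite inE zs orbT.
  exists ((u - a) * v); split; first by move=> /(prime_ideal_prime pP)[].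
  (* Both [u *: x - a *: x] and [v *: z - b *: x] lie in the span of [s]; this combination of them
     cancels [x]. *)
  have -> : ((u - a) * v) *: z =
      b *: (u *: x - a *: x) + (u - a) *: (v *: z - b *: x).
    rewrite -scalerBl scalerBr !scalerA [b * _]mulrC.
    by rewrite [RHS]addrC subrK.
  by apply: ideal_spanD => //; exact: ideal_spanZ.
move=> z; rewrite inE => /orP[/eqP ->|/kill //].
(* The element [(u - a) *: x] is a combination of generators already killed. *)
have [w [pw wE]] := torsion_ideal_span kill ux.
exists (w * (u - a)); split; first by move=> /(prime_ideal_prime pP)[].
by rewrite -scalerA scalerBl.
Qed.

End Nakayama.

(** * Dual bases and the converse *)

Section LinearCombination.
Context {A : comPzRingType} {M : lmodType A} {n : nat} (e : 'I_n -> M).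

Definition lin_comb (v : 'rV[A]_n) : M := \sum_(i < n) v 0 i *: e i.

Lemma lin_comb_is_linear : linear lin_comb.
Proof.
move=> a u v; rewrite /lin_comb scaler_sumr -big_split /=.
by apply: eq_bigr => i _; rewrite !mxE scalerDl scalerA.
Qed.

HB.instance Definition _ :=
  GRing.isLinear.Build A 'rV[A]_n M *:%R lin_comb lin_comb_is_linear.

End LinearCombination.

Section Coordinate.
Context {A : comPzRingType} {M : lmodType A} {n : nat}.
Variables (h : {linear M -> 'rV[A]_n}) (i : 'I_n).

Definition coordinate (x : M) : A^o := h x 0 i.

Lemma coordinate_is_linear : linear coordinate.
Proof. by move=> a x y; rewrite /coordinate linearP !mxE. Qed.

HB.instance Definition _ :=
  GRing.isLinear.Build A M A^o *:%R coordinate coordinate_is_linear.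

End Coordinate.

(** Projectivity splits the surjection [lin_comb e] from [A^n] onto [M]; the [f i] are the
    coordinates of the section. *)
Lemma dual_basis (A : comPzRingType) (M : lmodType A) :
  finitely_generated M -> projective M ->
  exists (n : nat) (e : 'I_n -> M) (f : 'I_n -> {linear M -> A^o}),
    forall x, x = \sum_(i < n) (f i x : A) *: e i.
Proof.
move=> [n [e gen]] proj.
have [|h hE] := proj 'rV[A]_n M (lin_comb e) (idfun : {linear M -> M}).
  move=> y; have [a ->] := gen y; exists (\row_i a i).
  by apply: eq_bigr => i _; rewrite mxE.
by exists n, e, (fun i => coordinate h i) => x; rewrite -{1}[x]hE.
Qed.

Lemma fg_projective_supp_trace (A : comPzRingType) (M : lmodType A)
  (p : spec A) :
  finitely_generated M -> projective M -> trace_ideal M `<=` p -> ~ supp M p.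
Proof.
move=> fg proj trp; have [n [e [f fE]]] := dual_basis fg proj.
(* The coefficients [f i x] lie in the trace ideal, hence in [p]: this is [M = p M]. *)
have span x : ideal_span p (map e (index_enum 'I_n)) x.
  rewrite [x]fE; apply: (@ideal_span_sum _ _ p n (fun i => f i x)) => i.
  exact/trp/trace_ideal_eval.
apply/not_suppP => x; apply: torsion_ideal_span (span x).
(* The denominator 1 suffices, since [span] covers [1 *: y]. *)
apply: local_nakayama => y _; exists 1; split=> //.
exact: prime_ideal1 (specP p).
Qed.

Theorem lemma3p1 (A : comPzRingType) (M : lmodType A) :
  (trace_ideal M = [set: A] -> supp M = [set: spec A]) /\
  (finitely_generated M -> projective M ->
     supp M = [set: spec A] -> trace_ideal M = [set: A]).
Proof.
split=> [trT|fg proj suppT].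
  by apply/seteqP; split=> // p _; apply: trace_full_supp; rewrite trT.
have trI := trace_ideal_is_ideal M.
have [tr1|tr1] := pselect (trace_ideal M 1).
  by apply/seteqP; split=> // a _; rewrite -[a]mulr1; exact: is_idealM.
have [p trp] := proper_ideal_sub_prime trI tr1.
by case: (fg_projective_supp_trace fg proj trp); rewrite suppT.
Qed.
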